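(* Let $x_1, x_2 \in \mathbb{R}^d$ be text embeddings of two documents with length $n$, decomposed as $$x_i = \mathcal{DC}[x_i] + \mathcal{HC}[x_i], \qquad i=1,2.$$ Assume $\lVert \mathcal{HC}[x_i] \rVert_2 \le \beta(n)$, where $\beta(n) = O(1/\sqrt{n})$, and $\lVert \mathcal{DC}[x_i] \rVert_2 \ge \alpha > 0$, where $\alpha$ is a constant. Then the cosine similarity satisfies $$\lim_{n \to \infty} \cos(x_1, x_2) = 1 .$$
   Context: The embeddings $x_1,x_2$ depend on the document length $n$ (number of tokens), and the limit is taken as this length grows. For a vector $x\in\mathbb{R}^m$, the direct-current (DC) component is its zero-frequency part under the discrete Fourier transform, $\mathcal{DC}[x]=\frac1m\boldsymbol{1}\boldsymbol{1}^{\top}x$, and the high-frequency component is the remainder, $\mathcal{HC}[x]=\left(\boldsymbol{I}-\frac1m\boldsymbol{1}\boldsymbol{1}^{\top}\right)x$, where $\boldsymbol{1}\in\mathbb{R}^m$ is the all-ones vector and $\boldsymbol{I}$ is the $m\times m$ identity; here $m=d$. The cosine similarity of nonzero vectors is $\cos(x,y)=\dfrac{x^{\top}y}{\lVert x\rVert_2\lVert y\rVert_2}$.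
   Formalization: The formal theorem also assumes that for all large n the DC components of x_1 and x_2 have positive inner product (point the same way); without this the claim fails, e.g. d=1, x_1=1, x_2=-1 gives cosine -1. *)

(* Defs.v *)
From HB Require Import structures.
From mathcomp Require Import all_boot all_order all_algebra.
From mathcomp Require Import all_classical all_reals all_analysis.

Set Implicit Arguments.
Unset Strict Implicit.
Unset Printing Implicit Defensive.

Import Order.TTheory GRing.Theory Num.Theory.
Import numFieldNormedType.Exports.

Local Open Scope ring_scope.

Section Components.
Variables (R : realType) (m : nat).
Implicit Types x y : 'cV[R]_m.

Definition ones : 'cV[R]_m := const_mx 1.

Definition DC x : 'cV[R]_m := m%:R^-1 *: (ones *m ones^T *m x).

Definition HC x : 'cV[R]_m := (1%:M - m%:R^-1 *: (ones *m ones^T)) *m x.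

Definition dotv x y : R := (x^T *m y) 0 0.

(* The norm [`|x|] that the library puts on matrices is the sup norm. *)
Definition norm2 x : R := Num.sqrt (dotv x x).

Definition cos_sim x y : R := dotv x y / (norm2 x * norm2 y).

Lemma DC_HC x : x = DC x + HC x.
Proof. by rewrite /DC /HC mulmxBl mul1mx -scalemxAl addrC subrK. Qed.

End Components.

(* Main.v *)
(** The DC parts of x1 and x2 are multiples of the all-ones vector and are
    orthogonal to the HC parts.  Since they point the same way,
      x1 . x2 >= a1 a2 - beta^2   and   |x1| |x2| <= a1 a2 + (a1 a2 / alpha^2) beta^2,
    where ai = |DC xi| >= alpha.  Hence 1 - 2 beta^2 / alpha^2 <= cos(x1, x2) <= 1,
    and beta^2 = O(1/n). *)
Require Import Defs.
From mathcomp Require Import all_boot all_order all_algebra.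
From mathcomp Require Import all_classical all_reals all_analysis.
From mathcomp Require Import ring lra.

Set Implicit Arguments.
Unset Strict Implicit.

Import Order.TTheory GRing.Theory Num.Theory.
Import numFieldNormedType.Exports.

Local Open Scope classical_set_scope.
Local Open Scope ring_scope.

Lemma dotvE (R : realType) (m : nat) (x y : 'cV[R]_m) :
  dotv x y = \sum_i x i 0 * y i 0.
Proof. by rewrite /dotv mxE; apply: eq_bigr => i _; rewrite mxE. Qed.

Lemma dotvC (R : realType) (m : nat) (x y : 'cV[R]_m) : dotv x y = dotv y x.
Proof. by rewrite !dotvE; apply: eq_bigr => i _; rewrite mulrC. Qed.

Lemma dotvDr (R : realType) (m : nat) (x y z : 'cV[R]_m) :
  dotv x (y + z) = dotv x y + dotv x z.
Proof. by rewrite /dotv mulmxDr mxE. Qed.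

Lemma dotvDl (R : realType) (m : nat) (x y z : 'cV[R]_m) :
  dotv (x + y) z = dotv x z + dotv y z.
Proof. by rewrite dotvC dotvDr !(dotvC z). Qed.

Lemma dotvZr (R : realType) (m : nat) (a : R) (x y : 'cV[R]_m) :
  dotv x (a *: y) = a * dotv x y.
Proof. by rewrite /dotv -scalemxAr mxE. Qed.

Lemma dotvZl (R : realType) (m : nat) (a : R) (x y : 'cV[R]_m) :
  dotv (a *: x) y = a * dotv x y.
Proof. by rewrite dotvC dotvZr dotvC. Qed.

Lemma dotv_ge0 (R : realType) (m : nat) (x : 'cV[R]_m) : 0 <= dotv x x.
Proof. by rewrite dotvE sumr_ge0// => i _; rewrite -expr2 sqr_ge0. Qed.

Lemma norm2_ge0 (R : realType) (m : nat) (x : 'cV[R]_m) : 0 <= norm2 x.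
Proof. exact: sqrtr_ge0. Qed.

Lemma sqr_norm2 (R : realType) (m : nat) (x : 'cV[R]_m) :
  norm2 x ^+ 2 = dotv x x.
Proof. by rewrite sqr_sqrtr// dotv_ge0. Qed.

(** Cauchy-Schwarz: with a = |x| and b = |y|, expanding |b x - a y|^2 >= 0 gives 2ab (ab - x.y) >=
    0, and ab > 0 can be cancelled. *)
Lemma cos_sim_le1 (R : realType) (m : nat) (x y : 'cV[R]_m) :
  0 < norm2 x -> 0 < norm2 y -> cos_sim x y <= 1.
Proof.
move=> x0 y0; rewrite /cos_sim ler_pdivrMr ?mulr_gt0// mul1r.
have := dotv_ge0 (norm2 y *: x + (- norm2 x) *: y).
rewrite !(dotvDl, dotvDr, dotvZl, dotvZr) -!sqr_norm2 (dotvC y x).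
set a := norm2 x in x0 *; set b := norm2 y in y0 *; set D := dotv x y.
rewrite (_ : _ + _ = 2 * (a * b) * (a * b - D)); last by ring.
by rewrite pmulr_rge0 ?mulr_gt0// subr_ge0.
Qed.

(** From |x + y|^2 >= 0. It bounds the product of the HC parts below by -b^2, and unlike
    [cos_sim_le1] it also covers HC parts that vanish. *)
Lemma dotv_ge_sqr_norm2 (R : realType) (m : nat) (x y : 'cV[R]_m) :
  - (norm2 x ^+ 2 + norm2 y ^+ 2) / 2 <= dotv x y.
Proof.
have := dotv_ge0 (x + y).
rewrite !(dotvDl, dotvDr) -!sqr_norm2 (dotvC y x) => ?; lra.
Qed.

Lemma DCE (R : realType) (m : nat) (x : 'cV[R]_m) :
  DC x = (m%:R^-1 * dotv (ones R m) x) *: ones R m.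
Proof.
rewrite /DC -mulmxA (mx11_scalar (_^T *m _)) mul_mx_scalar scalerA.
by congr (_ *: _).
Qed.

Lemma dotv_ones (R : realType) (m : nat) : dotv (ones R m) (ones R m) = m%:R.
Proof.
rewrite dotvE (eq_bigr (fun=> 1)) => [|i _]; last by rewrite !mxE mulr1.
by rewrite sumr_const card_ord.
Qed.

Lemma dotv_ones_HC (R : realType) (m : nat) (x : 'cV[R]_m) :
  dotv (ones R m) (HC x) = 0.
Proof.
have -> : HC x = x + (-1) *: DC x by rewrite {2}(DC_HC x) scaleN1r addrAC subrr add0r.
rewrite dotvDr dotvZr DCE dotvZr dotv_ones.
(* In dimension 0 the inverse of [m%:R] is 0 by convention and does not cancel, but every dot
   product is an empty sum. *)
case: m x => [|m] x; first by rewrite dotvE big_ord0 !mulr0 addr0.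
by rewrite mulrAC mulVf ?pnatr_eq0// mul1r mulN1r subrr.
Qed.

Lemma dotv_DC_HC (R : realType) (m : nat) (x y : 'cV[R]_m) :
  dotv (DC x) (HC y) = 0.
Proof. by rewrite DCE dotvZl dotv_ones_HC mulr0. Qed.

Lemma dotv_DC_add_HC (R : realType) (m : nat) (x y : 'cV[R]_m) :
  dotv x y = dotv (DC x) (DC y) + dotv (HC x) (HC y).
Proof.
rewrite {1}(DC_HC x) {1}(DC_HC y) !(dotvDl, dotvDr) dotv_DC_HC.
by rewrite (dotvC (HC x)) dotv_DC_HC addr0 add0r.
Qed.

(** Both vectors are multiples of [ones], so Cauchy-Schwarz is an equality up to sign: the squares
    agree, and the hypothesis selects the nonnegative root. *)
Lemma dotv_DC (R : realType) (m : nat) (x y : 'cV[R]_m) :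
  0 <= dotv (DC x) (DC y) -> dotv (DC x) (DC y) = norm2 (DC x) * norm2 (DC y).
Proof.
move=> xy0; apply/eqP; rewrite -(@eqrXn2 _ 2)// ?mulr_ge0 ?norm2_ge0//.
by apply/eqP; rewrite exprMn !sqr_norm2 !DCE !(dotvZl, dotvZr); ring.
Qed.

Lemma cos_sim_ge (R : realType) (m : nat) (x y : 'cV[R]_m) (a b : R) :
  0 < a -> a <= norm2 (DC x) -> a <= norm2 (DC y) ->
  norm2 (HC x) <= b -> norm2 (HC y) <= b -> 0 < dotv (DC x) (DC y) ->
  1 - 2 / a ^+ 2 * b ^+ 2 <= cos_sim x y <= 1.
Proof.
move=> a0 ax ay xb yb xy0.
have b0 : 0 <= b by rewrite (le_trans _ xb)// norm2_ge0.
(* Since b^2 = c a^2, the HC contributions are at most c times the DC ones; the errors in x.y and in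
   |x| |y| both become relative errors c. *)
set c := b ^+ 2 / a ^+ 2.
have c0 : 0 <= c by rewrite divr_ge0 ?sqr_ge0.
have -> : 2 / a ^+ 2 * b ^+ 2 = 2 * c by rewrite /c; ring.
have b2E : b ^+ 2 = c * a ^+ 2 by rewrite /c mulfVK// expf_neq0// gt_eqF.
have sqr_norm2_DC_HC (z : 'cV[R]_m) :
    norm2 z ^+ 2 = norm2 (DC z) ^+ 2 + norm2 (HC z) ^+ 2.
  by rewrite !sqr_norm2 (dotv_DC_add_HC z z).
have norm_ge (z : 'cV[R]_m) : norm2 (DC z) <= norm2 z.
  by rewrite -(@ler_pXn2r _ 2) ?nnegrE ?norm2_ge0// (sqr_norm2_DC_HC z) lerDl sqr_ge0.
have norm_le (z : 'cV[R]_m) : a <= norm2 (DC z) -> norm2 (HC z) <= b ->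
    norm2 z ^+ 2 <= norm2 (DC z) ^+ 2 * (1 + c).
  move=> az zb; rewrite (sqr_norm2_DC_HC z) mulrDr mulr1 lerD2l mulrC.
  apply: (@le_trans _ _ (b ^+ 2)).
    by rewrite ler_pXn2r ?nnegrE ?norm2_ge0.
  by rewrite b2E ler_wpM2l// ler_pXn2r ?nnegrE ?norm2_ge0// ltW.
have nx0 : 0 < norm2 x by apply: lt_le_trans a0 (le_trans ax _).
have ny0 : 0 < norm2 y by apply: lt_le_trans a0 (le_trans ay _).
rewrite cos_sim_le1// andbT /cos_sim ler_pdivlMr ?mulr_gt0//.
have DC_le : norm2 (DC x) * norm2 (DC y) <= norm2 x * norm2 y.
  by rewrite ler_pM// norm2_ge0.
have norm_prod_le : norm2 x * norm2 y <= norm2 (DC x) * norm2 (DC y) * (1 + c).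
  rewrite -(@ler_pXn2r _ 2) ?nnegrE ?mulr_ge0 ?norm2_ge0 ?addr_ge0//.
  have -> : (norm2 (DC x) * norm2 (DC y) * (1 + c)) ^+ 2 =
    (norm2 (DC x) ^+ 2 * (1 + c)) * (norm2 (DC y) ^+ 2 * (1 + c)) by ring.
  by rewrite exprMn ler_pM ?sqr_ge0// norm_le.
have dot_ge : norm2 (DC x) * norm2 (DC y) * (1 - c) <= dotv x y.
  rewrite dotv_DC_add_HC (dotv_DC (ltW xy0)) mulrBr mulr1 lerD2l.
  apply: le_trans (dotv_ge_sqr_norm2 _ _).
  have hx : norm2 (HC x) ^+ 2 <= b ^+ 2 by rewrite ler_pXn2r ?nnegrE ?norm2_ge0.
  have hy : norm2 (HC y) ^+ 2 <= b ^+ 2 by rewrite ler_pXn2r ?nnegrE ?norm2_ge0.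
  have : b ^+ 2 <= norm2 (DC x) * norm2 (DC y) * c.
    by rewrite b2E mulrC ler_wpM2r// expr2 ler_pM// ltW.
  lra.
(* With P = |DC x| |DC y| and N = |x| |y|: x.y >= P (1 - c) = P (1 + c) - 2cP >= N - 2cN, using N <=
   P (1 + c) and P <= N. *)
have : norm2 (DC x) * norm2 (DC y) * c <= norm2 x * norm2 y * c.
  by rewrite ler_wpM2r.
lra.
Qed.

(** [DC_aligned] excludes DC parts of opposite sign: for d > 0, nonzero constant vectors with x2 =
    -x1 have no HC part, yet their cosine is -1. *)
Theorem theorem8 (R : realType) (d : nat) (x1 x2 : nat -> 'cV[R]_d)
    (alpha : R) (beta : nat -> R)
    (beta_bigO : beta =O_\oo (fun n : nat => (Num.sqrt n%:R)^-1 : R))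
    (HC1_le : forall n : nat, (0 < n)%N -> norm2 (HC (x1 n)) <= beta n)
    (HC2_le : forall n : nat, (0 < n)%N -> norm2 (HC (x2 n)) <= beta n)
    (alpha_gt0 : 0 < alpha)
    (DC1_ge : forall n : nat, (0 < n)%N -> alpha <= norm2 (DC (x1 n)))
    (DC2_ge : forall n : nat, (0 < n)%N -> alpha <= norm2 (DC (x2 n)))
    (DC_aligned : \forall n \near \oo, 0 < dotv (DC (x1 n)) (DC (x2 n))) :
  cos_sim (x1 n) (x2 n) @[n --> \oo] --> (1 : R).
Proof.
have /eqO_exP[k k0 beta_le] := beta_bigO.
(* Eventually |beta n| <= k / sqrt n, so the error 2 (beta n)^2 / alpha^2 of [cos_sim_ge] is at most
   K / n. *)
pose K := 2 / alpha ^+ 2 * k ^+ 2.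
have Vn0 : (n%:R^-1 : R) @[n --> \oo] --> (0 : R).
  apply/gtr0_cvgV0; last exact: cvgr_idn.
  by near=> n; rewrite ltr0n; near: n; exact: nbhs_infty_gt.
have lb : 1 - K * (n%:R^-1 : R) @[n --> \oo] --> (1 : R).
  rewrite -[X in _ --> X]subr0 -(mulr0 K).
  by apply: cvgB; [exact: cvg_cst|exact: cvgMr].
apply: squeeze_cvgr lb (cvg_cst _); near=> n.
have n0 : (0 < n)%N by near: n; exact: nbhs_infty_gt.
have beta2 : beta n ^+ 2 <= k ^+ 2 * n%:R^-1.
  have : `|beta n| <= k * `|(Num.sqrt n%:R)^-1| by near: n.
  rewrite -(@ler_pXn2r _ 2) ?nnegrE ?mulr_ge0 ?(ltW k0)//.
  by rewrite exprMn !real_normK ?num_real// exprVn sqr_sqrtr.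
have /andP[lo ->] : 1 - 2 / alpha ^+ 2 * beta n ^+ 2
    <= cos_sim (x1 n) (x2 n) <= 1.
  by apply: cos_sim_ge; rewrite ?HC1_le ?HC2_le ?DC1_ge ?DC2_ge//; near: n.
rewrite andbT (le_trans _ lo)// lerB// /K -(mulrA _ (k ^+ 2)) ler_wpM2l//.
by rewrite divr_ge0 ?sqr_ge0.
Unshelve. all: by end_near. Qed.
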